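(* Let $K\ge 2$. Consider the $K$-armed Gaussian bandit under weighted information with mean parameter $\mu=(\mu_1,\dots,\mu_K)\in(\mathbb R^2)^K$ and variance parameter $\sigma=(\sigma_1^2,\dots,\sigma_K^2)\in(0,\infty)^K$, both unknown to the agent, with a unique optimal arm $k^\star=\arg\max_k\|\mu_k\|$ and gaps $\Delta_k=\|\mu_{k^\star}\|-\|\mu_k\|$. For every uniformly efficient policy $\pi\in\Pi^\star$, the expected cumulative regret satisfies $$\liminf_{T\to\infty}\frac{\mathbb E\{R^{\pi}_{\mu,\sigma}(T)\}}{\log T}\;\ge\;\sum_{k\neq k^\star}\frac{\sigma_k^2}{\Delta_k}.$$
   Context: Bandit under weighted information. There are $K$ arms with fixed means $\mu_k\in\mathbb R^2$ and variance parameters $\sigma_k^2>0$. $\|\cdot\|$ is the Euclidean norm, $k^\star=\arg\max_k\|\mu_k\|$ (assumed unique), $\Delta_k=\|\mu_{k^\star}\|-\|\mu_k\|$. At each round $t=1,2,\dots$ the agent chooses a power profile $p^{t,\pi}=(p^{t,\pi}_1,\dots,p^{t,\pi}_K)$ in the simplex $\Lambda=\{\xi\in[0,1]^K:\sum_k\xi_k=1\}$ and then observes $X^t=(X^t_1,\dots,X^t_K)$ where, given the past and $p^{t,\pi}$, the $X^t_k$ are independent with $X^t_k\sim\mathcal N\big(\mu_k,\tfrac{\sigma_k^2}{2p^{t,\pi}_k}I_2\big)$, $I_2$ being the $2\times2$ identity matrix; if $p^{t,\pi}_k=0$, the outcome of arm $k$ is non-informative (missing). $\Pi$ is the set of policies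 $\pi$ (not knowing $\mu,\sigma$) such that $p^{t,\pi}$ is $\mathcal F_t$-measurable for every $t$, where $\mathcal F_t$ is the $\sigma$-algebra generated by $(p^{1,\pi},X^1,\dots,p^{t-1,\pi},X^{t-1})$. The expected cumulative regret is $\mathbb E\{R^{\pi}_{\mu,\sigma}(T)\}=\sum_{t=1}^T\sum_{k=1}^K\|\mu_k\|\,(p^{t,\star}_k-\mathbb E\{p^{t,\pi}_k\})$, where $p^{t,\star}_{k^\star}=1$ and $p^{t,\star}_k=0$ for $k\ne k^\star$. A policy $\pi\in\Pi$ is uniformly efficient if, for every problem instance $(\mu,\sigma)$ with a unique optimal arm, every suboptimal arm $k\neq k^\star$ and every $\alpha>0$, $\mathbb E\{\sum_{t=1}^Tp^{t,\pi}_k\}=o(T^\alpha)$ as $T\to\infty$. The set of uniformly efficient policies is $\Pi^\star$. *)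

(* Defs.v *)
From HB Require Import structures.
From mathcomp Require Import all_boot all_order all_algebra.
From mathcomp Require Import all_classical all_reals all_analysis.

Set Implicit Arguments.
Unset Strict Implicit.
Unset Printing Implicit Defensive.

Import Order.TTheory GRing.Theory Num.Theory.
Import numFieldNormedType.Exports.

Local Open Scope classical_set_scope.
Local Open Scope ring_scope.

(* Rounds are numbered from 0: index t stands for round t + 1. The processes
   [p] (power profiles) and [X] (observed outcomes) live on one sample space;
   a family of probability measures on it, indexed by the problem instances
   (mu, sigma2), gives their law under each instance. Neither [p] nor [X]
   depends on the instance as a function, so the policy does not see it. *)

(* The canonical norm of R * R is the sup norm, hence this definition. *)
Definition enorm (R : realType) (m : R * R) : R :=
  Num.sqrt (m.1 ^+ 2 + m.2 ^+ 2).

Definition unique_best (R : realType) (K : nat) (mu : 'I_K -> R * R)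
    (kstar : 'I_K) : Prop :=
  forall k, k != kstar -> enorm (mu k) < enorm (mu kstar).

Definition gap (R : realType) (K : nat) (mu : 'I_K -> R * R)
    (kstar k : 'I_K) : R :=
  enorm (mu kstar) - enorm (mu k).

(* N(m, v I_2); the second argument of [normal_prob] is a standard
   deviation. *)
Definition gauss2 (R : realType) (m : R * R) (v : R) : set (R * R) -> \bar R :=
  (normal_prob m.1 (Num.sqrt v) \x normal_prob m.2 (Num.sqrt v))%E.

(* A missing outcome (power 0) is recorded as the constant (0, 0). As the power
   itself is part of the history, this is not confused with an actual
   observation, and it carries no information on the instance. *)
Definition outcome_law (R : realType) (m : R * R) (s2 q : R)
    (B : set (R * R)) : \bar R :=
  if q == 0 then \d_((0, 0) : R * R) B else gauss2 m (s2 / (2 * q)) B.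

Section Bandit.
Context (R : realType) (K : nat) (d : measure_display) (T : measurableType d).
Implicit Types (p : nat -> 'I_K -> {mfun T >-> R}).
Implicit Types (X : nat -> 'I_K -> {mfun T >-> (R * R)%type}).
Implicit Types (P : ('I_K -> R * R) -> ('I_K -> R) -> probability T R).

(* The sigma-algebra generated by the profiles of the first m rounds and the
   outcomes of the first n rounds. *)
Definition history p X (m n : nat) : set_system T :=
  <<s [set A | (exists s k (B : set R),
                  [/\ (s < m)%N, measurable B & A = p s k @^-1` B]) \/
               (exists s k (B : set (R * R)),
                  [/\ (s < n)%N, measurable B & A = X s k @^-1` B])] >>.

Definition policy p X : Prop :=
  (forall t w, (forall k, 0 <= p t k w <= 1) /\ \sum_(k < K) p t k w = 1) /\
  (forall t k (B : set R), measurable B -> history p X t t (p t k @^-1` B)).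

(* Given the past and the current profile, the outcomes of the K arms are
   independent with their respective laws. *)
Definition weighted_information P p X : Prop :=
  forall (mu : 'I_K -> R * R) (sigma2 : 'I_K -> R), (forall k, 0 < sigma2 k) ->
  forall t (A : set T) (B : 'I_K -> set (R * R)),
    history p X t.+1 t A -> (forall k, measurable (B k)) ->
    (P mu sigma2 (A `&` [set w | forall k, B k (X t k w)]) =
     \int[P mu sigma2]_(w in A)
       \prod_(k < K) outcome_law (mu k) (sigma2 k) (p t k w) (B k))%E.

Definition expected_power P p (mu : 'I_K -> R * R) (sigma2 : 'I_K -> R)
    (k : 'I_K) (n : nat) : R :=
  fine 'E_(P mu sigma2)[fun w => \sum_(t < n) p t k w].

Definition uniformly_efficient P p : Prop :=
  forall (mu : 'I_K -> R * R) (sigma2 : 'I_K -> R) (kstar : 'I_K),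
    (forall k, 0 < sigma2 k) -> unique_best mu kstar ->
  forall k : 'I_K, k != kstar -> forall alpha : R, 0 < alpha ->
    expected_power P p mu sigma2 k =o_\oo (fun n : nat => n%:R `^ alpha).

Definition expected_regret P p (mu : 'I_K -> R * R) (sigma2 : 'I_K -> R)
    (kstar : 'I_K) (n : nat) : R :=
  \sum_(t < n) \sum_(k < K)
    enorm (mu k) * ((k == kstar)%:R - fine 'E_(P mu sigma2)[p t k]).

End Bandit.

(* Main.v *)
(* Change of measure.  Fix a suboptimal arm k, write mu_k = |mu_k| u with u a
   unit vector, and let mu1 be mu with the mean of arm k moved by v = x u,
   x > gap k, so that k is optimal under mu1.  On the history of n rounds the law
   under mu1 has a density M1 with respect to the law under mu, a product of
   Gaussian likelihood ratios, and
     - ln M1 = |v|^2 / sigma_k^2 * N_k + (a centered term linear in the outcomes),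
   where N_k is the total power spent on k.  The centered term is removed without
   computing any moment: with mu2 the instance in which arm k is moved by
   - tau v, one has
     - ln M1 = (1 + tau) |v|^2 / sigma_k^2 * N_k + ln M2 / tau
   and ln M2 <= M2 - 1 has nonpositive expectation.  On the other hand, with
   Z = N_k / n, the bounds ln M1 <= M1 / c - 1 + ln c and ln M1 <= M1 - 1, weighted
   by 1 - Z and Z, give
     (1 - E Z) (1 - ln c) <= (1 - E1 Z) / c + 1 + (1 + tau) |v|^2 / sigma_k^2 * E N_k.
   Uniform efficiency under mu and mu1 with c = n^(tau - 1) yields
   E N_k >= (1 - o(1)) sigma_k^2 / gap_k^2 * ln n. *)

Require Import Defs.
From HB Require Import structures.
From mathcomp Require Import all_boot all_order all_algebra.
From mathcomp Require Import all_classical all_reals all_analysis.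
From mathcomp Require Import measurable_realfun normal_distribution ring lra.

Set Implicit Arguments.
Unset Strict Implicit.
Unset Printing Implicit Defensive.

Import Order.TTheory GRing.Theory Num.Theory.
Import numFieldNormedType.Exports.

Local Open Scope classical_set_scope.
Local Open Scope ring_scope.

(** * Densities and disintegration *)

Section Disintegration.
Local Open Scope ereal_scope.
Import HBNNSimple.

(** The hypothesis on [nu] is the case of indicators. Linearity extends it to nonnegative simple
    functions, and monotone convergence along [nnsfun_approx] extends it to [h]. Finiteness of [f]
    lets the limit pass through the product with [f x]. *)
Lemma ge0_integral_density d (T : measurableType d) (R : realType)
    (mu nu : {measure set T -> \bar R}) (f : T -> \bar R) :
  measurable_fun setT f -> (forall x, 0 <= f x) ->
  (forall x, f x \is a fin_num) ->
  (forall A, measurable A -> nu A = \int[mu]_(x in A) f x) ->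
  forall h : T -> \bar R, measurable_fun setT h -> (forall x, 0 <= h x) ->
  \int[nu]_x h x = \int[mu]_x (h x * f x).
Proof.
move=> mf f0 ffin nuE h mh h0.
have indicE A : measurable A -> \int[nu]_x (\1_A x)%:E = \int[mu]_x ((\1_A x)%:E * f x).
  move=> mA; rewrite integral_indic// setIT nuE// integral_mkcond.
  by apply: eq_integral => x _; rewrite patchE indicE; case: (x \in A); rewrite ?mul1e ?mul0e.
pose g := nnsfun_approx measurableT mh.
have gcvg x : (g n x)%:E @[n --> \oo] --> h x by exact: cvg_nnsfun_approx.
have gnd x a b : (a <= b)%N -> (g a x <= g b x)%R.
  by move=> ab; exact/lefP/nd_nnsfun_approx.
have gE n : \int[nu]_x (g n x)%:E = \int[mu]_x ((g n x)%:E * f x).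
  under eq_integral do rewrite fimfunE -fsumEFin//.
  under [RHS]eq_integral.
    move=> x _; rewrite fimfunE -fsumEFin// ge0_mule_fsuml; last first.
      by move=> r; rewrite nnfun_muleindic_ge0.
    over.
  rewrite ge0_integral_fsum//; last 2 first.
  - by move=> r; exact/measurable_EFinP/measurableT_comp.
  - by move=> r x _; rewrite nnfun_muleindic_ge0.
  rewrite ge0_integral_fsum//; last 2 first.
  - by move=> r; apply: emeasurable_funM => //; exact/measurable_EFinP/measurableT_comp.
  - by move=> r x _; rewrite mule_ge0// nnfun_muleindic_ge0.
  apply: eq_fsbigr => r _.
  (* A negative [r] is not a value of the nonnegative [g n]: its preimage is empty and both
     integrals vanish. *)
  have [r0|r0] := leP 0%R r; last first.
    rewrite integral0_eq ?integral0_eq//.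
      by move=> x _; rewrite preimage_nnfun0// indic0 mulr0 mul0e.
    by move=> x _; rewrite preimage_nnfun0// indic0 mulr0.
  under eq_integral do rewrite EFinM.
  under [RHS]eq_integral do rewrite EFinM -muleA.
  rewrite !ge0_integralZl//.
  - by rewrite indicE.
  - by apply: emeasurable_funM => //; exact/measurable_EFinP.
  - by move=> x _; rewrite mule_ge0.
  - exact/measurable_EFinP.
transitivity (limn (fun n => \int[nu]_x (g n x)%:E)).
  rewrite -monotone_convergence//.
  - by apply: eq_integral => x _; apply/esym/cvg_lim => //; exact: gcvg.
  - by move=> n; exact/measurable_EFinP.
  - by move=> n x _; rewrite lee_fin.
  - by move=> x _ a b ab; rewrite lee_fin gnd.
under eq_fun do rewrite gE.
rewrite -monotone_convergence//.
- apply: eq_integral => x _; apply/cvg_lim => //.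
  by apply: cvgeZr; [exact: ffin|exact: gcvg].
- by move=> n; apply: emeasurable_funM => //; exact/measurable_EFinP.
- by move=> n x _; rewrite mule_ge0// lee_fin.
- by move=> x _ a b ab; rewrite lee_wpmul2r// lee_fin gnd.
Qed.

(** * Image measures and kernels built from them *)

Section image_measure.
Context d d' (T : measurableType d) (T' : measurableType d') (R : realType).
Variables (mu : {measure set T -> \bar R}) (f : {mfun T >-> T'}).

Definition image_measure (A : set T') : \bar R := mu (f @^-1` A).

Let push A : image_measure A = pushforward mu f A. Proof. by []. Qed.

Let image_measure0 : image_measure set0 = 0.
Proof. by rewrite push measure0. Qed.

Let image_measure_ge0 A : 0 <= image_measure A.
Proof. by rewrite push measure_ge0. Qed.

Let image_measure_sigma_additive : semi_sigma_additive image_measure.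
Proof. exact: (@measure_semi_sigma_additive _ _ _ (pushforward mu f)). Qed.

HB.instance Definition _ := isMeasure.Build _ _ _ image_measure
  image_measure0 image_measure_ge0 image_measure_sigma_additive.

Lemma ge0_integral_image_measure (g : T' -> \bar R) A : measurable A ->
  measurable_fun setT g -> (forall y, 0 <= g y) ->
  \int[image_measure]_(y in A) g y = \int[mu]_(x in f @^-1` A) g (f x).
Proof.
move=> mA mg g0.
by rewrite -(@ge0_integral_pushforward _ _ _ _ _ f)//; exact: measurable_funTS.
Qed.

End image_measure.

Section finite_measure_kernel.
Context d (T : measurableType d) (R : realType).
Variables (nu : {measure set T -> \bar R}) (nuoo : nu setT < +oo).

(** A finite measure seen as a kernel from the one-point space. The proof of finiteness is an
    argument so that the finite-kernel instance can be attached to the term. *)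
Definition constant_kernel (oo : nu setT < +oo) (_ : unit) : {measure set T -> \bar R} := nu.

Let measurable_constant_kernel U : measurable U -> measurable_fun [set: unit] (constant_kernel nuoo ^~ U).
Proof. by move=> mU; exact: measurable_cst. Qed.

HB.instance Definition _ := isKernel.Build _ _ _ _ R (constant_kernel nuoo) measurable_constant_kernel.

Let constant_kernel_uub : measure_fam_uub (constant_kernel nuoo).
Proof.
exists (fine (nu setT) + 1)%R => x /=.
by rewrite /constant_kernel EFinD fineK ?ge0_fin_numE// lteDl ?ge0_fin_numE// lte01.
Qed.

HB.instance Definition _ := Kernel_isFinite.Build _ _ _ _ R (constant_kernel nuoo) constant_kernel_uub.

End finite_measure_kernel.

Section kernel_graph.
Context d d' (T : measurableType d) (U : measurableType d') (R : realType).
Variable k : R.-pker T ~> U.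

Definition pair_mfun (x : T) : {mfun U >-> (T * U)%type} :=
  HB.pack (pair x) (isMeasurableFun.Build _ _ _ _ (pair x) (measurable_pair1 x)).

(* The [unit] component is the source of the kernel [constant_kernel], as
   required by the composition [mkcomp]. *)
Definition graph_kernel (x : unit * T) : {measure set (T * U) -> \bar R} :=
  image_measure (k x.2) (pair_mfun x.2).

Let measurable_graph_kernel V : measurable V -> measurable_fun [set: unit * T] (graph_kernel ^~ V).
Proof.
move=> mV; have mVk : measurable_fun setT (fun y : T => k y (xsection V y)).
  by apply: measurable_fun_xsection_finite_kernel; rewrite inE.
rewrite (_ : graph_kernel ^~ V = (fun y : T => k y (xsection V y)) \o snd).
  exact: measurableT_comp mVk _.
apply/funext => -[x y] /=; rewrite /graph_kernel/= /image_measure/=; congr (k _ _).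
by apply/seteqP; split => u; rewrite /xsection/= inE.
Qed.

HB.instance Definition _ := isKernel.Build _ _ _ _ R graph_kernel measurable_graph_kernel.

Let graph_kernel_uub : measure_fam_uub graph_kernel.
Proof.
by exists 2%R => x; rewrite /graph_kernel/= /image_measure preimage_setT prob_kernel lte_fin ltr1n.
Qed.

HB.instance Definition _ := Kernel_isFinite.Build _ _ _ _ R graph_kernel graph_kernel_uub.
End kernel_graph.

(** The joint law of [iota] and [Y], and the law of [iota] composed with the graph of [k], are
    finite measures on the product that agree on rectangles by hypothesis. Rectangles form a
    pi-system, so the two measures are equal and have the same integrals. *)
Lemma kernel_disintegration d d' d'' (T : measurableType d) (T' : measurableType d')
  (U : measurableType d'') (R : realType) (nu : {measure set T -> \bar R})
  (iota : {mfun T >-> T'}) (Y : {mfun T >-> U}) (k : R.-pker T' ~> U) :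
  nu setT < +oo ->
  (forall A B, measurable A -> measurable B ->
    nu (iota @^-1` A `&` Y @^-1` B) = \int[nu]_(w in iota @^-1` A) k (iota w) B) ->
  forall g : T' * U -> \bar R, measurable_fun setT g -> (forall z, 0 <= g z) ->
  \int[nu]_w g (iota w, Y w) = \int[nu]_w \int[k (iota w)]_u g (iota w, u).
Proof.
move=> nuoo nuE g mg g0.
have mIY : measurable_fun setT (fun w => (iota w, Y w)) by exact/measurable_fun_pair.
pose q : {measure set T' -> \bar R} := image_measure nu iota.
have qoo : q setT < +oo by rewrite /q/= /image_measure preimage_setT.
pose IY : {mfun T >-> (T' * U)%type} := HB.pack (fun w => (iota w, Y w))
  (isMeasurableFun.Build _ _ _ _ _ mIY).
pose m1 : {measure set (T' * U) -> \bar R} := image_measure nu IY.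
pose m2 : {measure set (T' * U) -> \bar R} := mkcomp (constant_kernel qoo) (graph_kernel k) tt.
have m12 E : measurable E -> m1 E = m2 E.
  pose G := [set A `*` B | A in (@measurable _ T') & B in (@measurable _ U)].
  apply: (measure_unique G (fun=> setT)).
  - by rewrite measurable_prod_measurableType.
  - move=> _ _ [A mA [B mB <-]] [A' mA' [B' mB' <-]].
    rewrite -setXI; exists (A `&` A'); first exact: measurableI.
    by exists (B `&` B') => //; exact: measurableI.
  - by move=> _; exists setT => //; exists setT => //; rewrite setXTT.
  - by rewrite bigcup_const.
  - move=> _ [A mA [B mB <-]].
    transitivity (nu (iota @^-1` A `&` Y @^-1` B)) => //.
    rewrite nuE// /m2/= /kcomp/= /graph_kernel/constant_kernel.
    rewrite /q ge0_integral_image_measure//=; last first.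
      have mk := measurable_kernel (graph_kernel k) _ (measurableX mA mB).
      exact: (measurableT_comp mk (measurable_pair1 tt)).
    rewrite preimage_setT integral_mkcond.
    apply: eq_integral => w _; rewrite patchE /image_measure /=.
    case: ifPn => wA.
      by congr (k _ _); apply/seteqP; split => u //=; [split=> //; rewrite inE in wA|case].
    rewrite (_ : _ @^-1` _ = set0) ?measure0//.
    by apply/seteqP; split => u //= -[]; rewrite notin_setE in wA.
  - by move=> _; rewrite /m1/= /image_measure preimage_setT.
transitivity (\int[m1]_z g z).
  by rewrite ge0_integral_image_measure//= preimage_setT.
rewrite (eq_measure_integral m2)//; last by move=> E mE _; exact: m12.
rewrite /m2/= integral_kcomp//= /q ge0_integral_image_measure//=; last first.
- by move=> y; exact: integral_ge0.
- rewrite [X in measurable_fun _ X](_ : _ = fun y => \int[k y]_u g (y, u)).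
    exact: measurable_fun_integral_finite_kernel.
  by apply/funext => y /=; rewrite ge0_integral_image_measure//= preimage_setT.
rewrite preimage_setT; apply: eq_integral => w _ /=.
rewrite ge0_integral_image_measure//= ?preimage_setT//.
Qed.

Lemma ge0_integral_density_set d (T : measurableType d) (R : realType)
    (mu nu : {measure set T -> \bar R}) (f : T -> \bar R) :
  measurable_fun setT f -> (forall x, 0 <= f x) -> (forall x, f x \is a fin_num) ->
  (forall A, measurable A -> nu A = \int[mu]_(x in A) f x) ->
  forall (h : T -> \bar R) A, measurable A ->
  measurable_fun setT h -> (forall x, 0 <= h x) ->
  \int[nu]_(x in A) h x = \int[mu]_(x in A) (h x * f x).
Proof.
move=> mf f0 ffin nuE h A mA mh h0; rewrite integral_mkcond.
rewrite (ge0_integral_density mf f0 ffin nuE)//; first last.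
- by move=> x; rewrite patchE; case: ifP.
- by apply/(measurable_restrictT _ _).1 => //; exact: measurable_funTS.
rewrite [RHS]integral_mkcond; apply: eq_integral => x _.
by rewrite !patchE; case: ifP; rewrite ?mul0e.
Qed.

(* [iota] is the past, [Y] the outcome of the arm whose law changes, with
   conditional laws [k] and [k'], and [S] an event on the other arms, with the
   same conditional probability [c] given the past under both measures. *)
Lemma one_step_density d d' d'' (T : measurableType d) (T' : measurableType d')
    (U : measurableType d'') (R : realType) (Q Q' : {measure set T -> \bar R})
    (iota : {mfun T >-> T'}) (Y : {mfun T >-> U}) (S : set T) (c M : T' -> R)
    (k k' : R.-pker T' ~> U) (e : T' * U -> R) :
  Q setT < +oo -> measurable S ->
  measurable_fun setT c -> (forall y, (0 <= c y)%R) ->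
  measurable_fun setT M -> (forall y, (0 <= M y)%R) ->
  measurable_fun setT e -> (forall z, (0 <= e z)%R) ->
  (forall A B, measurable A -> measurable B ->
    Q (iota @^-1` A `&` S `&` Y @^-1` B) =
    \int[Q]_(w in iota @^-1` A) ((c (iota w))%:E * k (iota w) B)) ->
  (forall A B, measurable A -> measurable B ->
    Q' (iota @^-1` A `&` S `&` Y @^-1` B) =
    \int[Q']_(w in iota @^-1` A) ((c (iota w))%:E * k' (iota w) B)) ->
  (forall A, measurable A ->
    Q' (iota @^-1` A) = \int[Q]_(w in iota @^-1` A) (M (iota w))%:E) ->
  (forall y B, measurable B -> k' y B = \int[k y]_(x in B) (e (y, x))%:E) ->
  forall A B, measurable A -> measurable B ->
  Q' (iota @^-1` A `&` S `&` Y @^-1` B) =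
  \int[Q]_(w in iota @^-1` A `&` S `&` Y @^-1` B) (M (iota w) * e (iota w, Y w))%:E.
Proof.
move=> Qoo mS mc c0 mM M0 me e0 QE Q'E Q'Q k'k A B mA mB.
pose Qi : {measure set T' -> \bar R} := image_measure Q iota.
pose Q'i : {measure set T' -> \bar R} := image_measure Q' iota.
pose QS : {measure set T -> \bar R} := mrestr Q mS.
pose QSi : {measure set T' -> \bar R} := image_measure QS iota.
have mk B' : measurable B' -> measurable_fun setT (k ^~ B') by exact: measurable_kernel.
have mk' B' : measurable B' -> measurable_fun setT (k' ^~ B') by exact: measurable_kernel.
have mcE : measurable_fun setT (EFin \o c) by exact/measurable_EFinP.
have mME : measurable_fun setT (EFin \o M) by exact/measurable_EFinP.
have Q'iE A' : measurable A' -> Q'i A' = \int[Qi]_(y in A') (EFin \o M) y.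
  move=> mA'; rewrite ge0_integral_image_measure//=.
  exact: Q'Q.
(* With [B] equal to [setT] the kernel contributes mass 1, so [c] is the density of the past
   restricted to [S]. *)
have QSiE A' : measurable A' -> QSi A' = \int[Qi]_(y in A') (EFin \o c) y.
  move=> mA'; rewrite ge0_integral_image_measure//=.
  rewrite /QSi/QS/=/image_measure/=/mrestr.
  rewrite -[X in Q X]setIT -(preimage_setT Y) QE//.
  by apply: eq_integral => w _; rewrite prob_kernel mule1.
(* Conditional independence of the arms: restricting to [S] reweights the past by [c] but leaves the
   conditional law [k] of [Y] unchanged. *)
have disint g : measurable_fun setT g -> (forall z, 0 <= g z) ->
    \int[QS]_w g (iota w, Y w) = \int[QS]_w \int[k (iota w)]_u g (iota w, u).
  move=> mg g0; apply: kernel_disintegration => //.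
    by rewrite /QS/= /mrestr setTI (le_lt_trans _ Qoo)// le_measure ?inE.
  move=> A' B' mA' mB'.
  rewrite -(@ge0_integral_image_measure _ _ _ _ _ QS iota (k ^~ B'))//; last exact: mk.
  rewrite (@ge0_integral_density_set _ _ _ Qi QSi (EFin \o c))//; last exact: mk.
  rewrite ge0_integral_image_measure//=; last 2 first.
  - apply: emeasurable_funM => //; exact: mk.
  - by move=> y; rewrite mule_ge0// lee_fin.
  rewrite /QS/= /mrestr setIAC QE//.
  by apply: eq_integral => w _; rewrite muleC.
(* From [Q'] the density [M] leads to [Q]; the factor [c] is then absorbed by passing to [QS]. There
   [k'] is replaced by [k] with density [e], and [disint] recombines past and outcome. *)
rewrite Q'E//.
rewrite -(@ge0_integral_image_measure _ _ _ _ _ Q' iota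
  (fun y => (c y)%:E * k' y B))//; last 2 first.
- apply: emeasurable_funM => //; exact: mk'.
- by move=> y; rewrite mule_ge0// lee_fin.
rewrite (@ge0_integral_density_set _ _ _ Qi Q'i (EFin \o M))//; last 2 first.
- apply: emeasurable_funM => //; exact: mk'.
- by move=> y; rewrite mule_ge0// lee_fin.
under eq_integral do rewrite -muleA muleC.
rewrite -(@ge0_integral_density_set _ _ _ Qi QSi (EFin \o c))//; last 2 first.
- apply: emeasurable_funM => //; exact: mk'.
- by move=> y; rewrite mule_ge0// lee_fin.
rewrite ge0_integral_image_measure//=; last 2 first.
- apply: emeasurable_funM => //; exact: mk'.
- by move=> y; rewrite mule_ge0// lee_fin.
pose g (z : T' * U) := ((M z.1 * e z)%:E * (\1_(A `*` B) z)%:E).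
have g0 z : 0 <= g z by rewrite mule_ge0 ?lee_fin// mulr_ge0.
have mg : measurable_fun setT g.
  apply: emeasurable_funM; apply/measurable_EFinP.
    by apply: measurable_funM => //; exact: measurableT_comp.
  by apply: measurable_indic; exact: measurableX.
transitivity (\int[QS]_w g (iota w, Y w)); last first.
  have QSE A' : measurable A' -> QS A' = \int[Q]_(w in A') (EFin \o \1_S) w.
    by move=> mA'; rewrite /= integral_indic// setIC.
  rewrite (ge0_integral_density _ _ _ QSE)//; first last.
  - exact: measurableT_comp mg (measurable_fun_pair _ _).
  - by move=> x; rewrite lee_fin.
  - by apply/measurable_EFinP; exact: measurable_indic.
  rewrite [RHS]integral_mkcond; apply: eq_integral => w _.
  have memE : ((iota w, Y w) \in A `*` B) = (w \in iota @^-1` A) && (w \in Y @^-1` B).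
    by rewrite in_setX.
  rewrite patchE /g [in LHS]indicE memE [(_ \o _) w]/= indicE !in_setI.
  by do 3 case: (_ \in _); rewrite ?mule0 ?mul0e ?mule1.
rewrite disint// [LHS]integral_mkcond; apply: eq_integral => w _.
rewrite patchE k'k//; case: ifPn => wA; last first.
  rewrite integral0_eq// => u _; rewrite /g indicE in_setX.
  rewrite (_ : (_ \in A) = false) ?mule0//; apply/negbTE.
  by move: wA; rewrite !notin_setE.
rewrite -ge0_integralZr//; last 3 first.
- by apply: measurable_funTS; apply/measurable_EFinP; exact:
    measurableT_comp me (measurable_pair1 (iota w)).
- by move=> u _; rewrite lee_fin.
- by rewrite lee_fin.
rewrite integral_mkcond; apply: eq_integral => u _.
rewrite patchE /g indicE in_setX (_ : (_ \in A) = true); last first.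
  by have := wA; rewrite inE => ?; apply/mem_set.
by case: (u \in B); rewrite /= ?mule0// mule1 -EFinM mulrC.
Qed.

End Disintegration.

(** * Gaussian outcomes *)

(** The density of the planar normal law of mean [m] and covariance [v] times the identity, for
    [v = s2 / (2 * q)]: the constant is [1 / (2 * pi * v)]. The power [q] is the first coordinate of
    [z], which makes joint measurability in power and outcome available. *)
Definition gauss_density (R : realType) (m : R * R) (s2 : R) (z : R * (R * R)) : R :=
  z.1 / (pi * s2) * expR (- (z.1 * ((z.2.1 - m.1) ^+ 2 + (z.2.2 - m.2) ^+ 2) / s2)).

Lemma measurable_gauss_density (R : realType) (m : R * R) (s2 : R) :
  measurable_fun setT (gauss_density m s2).
Proof.
have m1 : measurable_fun setT (fun z : R * (R * R) => z.2.1) by exact: measurableT_comp.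
have m2 : measurable_fun setT (fun z : R * (R * R) => z.2.2) by exact: measurableT_comp.
apply: measurable_funM; first by apply: measurable_funM.
apply: measurableT_comp => //; apply: measurableT_comp => //.
apply: measurable_funM => //; apply: measurable_funM => //.
by apply: measurable_funD; apply: measurable_funX; apply: measurable_funB.
Qed.

Lemma normal_pdf_mul (R : realType) (m : R * R) (s2 q x y : R) : 0 < s2 -> 0 < q ->
  normal_pdf m.1 (Num.sqrt (s2 / (2 * q))) x * normal_pdf m.2 (Num.sqrt (s2 / (2 * q))) y =
  gauss_density m s2 (q, (x, y)).
Proof.
move=> s0 q0.
have v0 : 0 < s2 / (2 * q) by rewrite divr_gt0// mulr_gt0.
have p0 : 0 < pi :> R by exact: pi_gt0.
rewrite !normal_pdfE ?gt_eqF ?sqrtr_gt0//= /gauss_density/= /normal_peak /normal_fun.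
rewrite sqr_sqrtr ?ltW// mulrACA -expRD -invfM -expr2 sqr_sqrtr; last first.
  by rewrite mulrn_wge0// mulr_ge0 ?ltW.
congr (_ * expR _).
  by move: (pi : R) p0 => c p0; field; rewrite !gt_eqF//.
by field; rewrite !gt_eqF//.
Qed.

(* [R] and [measurableTypeR R] have the same Borel sets, but their measurable
   structures carry different displays. *)
Lemma measurable_borel2_id (R : realType) :
  measurable_fun [set: measurableTypeR R * measurableTypeR R] (id : _ -> (R * R)%type).
Proof. by move=> _ B mB; rewrite setTI. Qed.

Definition borel2_id (R : realType) :
    {mfun (measurableTypeR R * measurableTypeR R)%type >-> (R * R)%type} :=
  HB.pack (id : _ -> (R * R)%type)
    (isMeasurableFun.Build _ _ _ _ _ (@measurable_borel2_id R)).

Definition lebesgue2 (R : realType) : {measure set (R * R) -> \bar R} :=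
  image_measure (lebesgue_measure \x lebesgue_measure)%E (borel2_id R).

Definition gauss2_measure (R : realType) (m : R * R) (v : R) : {measure set (R * R) -> \bar R} :=
  image_measure (normal_prob m.1 (Num.sqrt v) \x normal_prob m.2 (Num.sqrt v))%E (borel2_id R).

Lemma gauss_density_ge0 (R : realType) (m : R * R) (s2 q : R) z :
  0 < s2 -> 0 <= q -> 0 <= gauss_density m s2 (q, z).
Proof.
by move=> s0 q0; rewrite mulr_ge0 ?expR_ge0// divr_ge0// mulr_ge0 ?pi_ge0// ltW.
Qed.

Lemma measurable_gauss_density2 (R : realType) (m : R * R) (s2 q : R) :
  measurable_fun setT (fun z => (gauss_density m s2 (q, z))%:E).
Proof.
apply/measurable_EFinP.
exact: (measurableT_comp (measurable_gauss_density m s2) (measurable_pair1 q)).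
Qed.

(** Tonelli on the plane. The iterated form serves both to identify [gauss2] and to prove that
    outcome laws depend measurably on the power. *)
Lemma integral_gauss_density (R : realType) (m : R * R) (s2 q : R) (B : set (R * R)) :
  0 < s2 -> 0 <= q -> measurable B ->
  (\int[lebesgue2 R]_(z in B) (gauss_density m s2 (q, z))%:E =
   \int[lebesgue_measure]_x \int[lebesgue_measure]_y
     ((\1_B (x, y))%:E * (gauss_density m s2 (q, (x, y)))%:E))%E.
Proof.
move=> s0 q0 mB.
have gd0 z : 0 <= gauss_density m s2 (q, z) by exact: gauss_density_ge0.
rewrite ge0_integral_image_measure//; last exact: measurable_gauss_density2.
rewrite [LHS]integral_mkcond.
transitivity (\int[lebesgue_measure \x lebesgue_measure]_z
    ((\1_B z)%:E * (gauss_density m s2 (q, z))%:E))%E.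
  apply: eq_integral => z _.
  by rewrite patchE indicE; case: (z \in B); rewrite ?mul1e ?mul0e.
rewrite fubini_tonelli1//=; last by move=> z; rewrite mule_ge0// lee_fin.
apply: emeasurable_funM; apply/measurable_EFinP; first exact: measurable_indic.
exact: (measurableT_comp (measurable_gauss_density m s2) (measurable_pair1 q)).
Qed.

Lemma gauss2E (R : realType) (m : R * R) (s2 q : R) (B : set (R * R)) :
  0 < s2 -> 0 < q -> measurable B ->
  (gauss2 m (s2 / (2 * q)) B =
  \int[lebesgue2 R]_(z in B) (gauss_density m s2 (q, z))%:E)%E.
Proof.
move=> s0 q0 mB; set sd := Num.sqrt (s2 / (2 * q)).
have pdf0 mm x : (0 <= (normal_pdf mm sd x)%:E)%E by rewrite lee_fin normal_pdf_ge0.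
have mpdf mm : measurable_fun setT (fun x => (normal_pdf mm sd x)%:E).
  by apply/measurable_EFinP; exact: measurable_normal_pdf.
have NE (mm : R) (A : set (measurableTypeR R)) : measurable A ->
  (normal_prob mm sd A = \int[lebesgue_measure]_(x in A) (normal_pdf mm sd x)%:E)%E by [].
rewrite integral_gauss_density ?ltW//.
rewrite /gauss2 /product_measure1 /=.
rewrite (@ge0_integral_density _ (measurableTypeR R) R lebesgue_measure
  (normal_prob m.1 sd) _ (mpdf m.1) _ _ (NE _))//; last first.
  exact: (measurable_fun_xsection (normal_prob m.2 sd)).
apply: eq_integral => x _; rewrite /= /fubini_F/=.
rewrite muleC -ge0_integralZl//=; last 2 first.
- exact: measurable_xsection.
- by apply: measurable_funTS; exact: mpdf.
rewrite integral_mkcond; apply: eq_integral => y _.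
rewrite patchE indicE -normal_pdf_mul//.
have -> : (y \in xsection B x) = ((x, y) \in B) by rewrite mem_xsection.
by case: (_ \in B); rewrite ?mul1e ?mul0e.
Qed.

(* Nonpositive powers are sent to the Dirac law so that the kernel is total. *)
Definition outcome_measure (R : realType) (m : R * R) (s2 q : R) :
    {measure set (R * R) -> \bar R} :=
  if 0 < q then
gauss2_measure m (s2 / (2 * q)) else \d_((0, 0) : R * R).

Lemma outcome_measureE (R : realType) (m : R * R) (s2 q : R) (B : set (R * R)) :
  0 <= q -> outcome_measure m s2 q B = outcome_law m s2 q B.
Proof.
by rewrite le_eqVlt /outcome_measure /outcome_law => /orP[/eqP <-|q0];
  [rewrite ltxx eqxx|rewrite q0 gt_eqF].
Qed.

(** The quotient of the Gaussian densities of means [m'] and [m] at equal variance. The normalizing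
    constants cancel, which leaves an expression meaningful at every power. *)
Definition likelihood_ratio (R : realType) (m m' : R * R) (s2 : R) (z : R * (R * R)) : R :=
  expR (z.1 / s2 * (((z.2.1 - m.1) ^+ 2 + (z.2.2 - m.2) ^+ 2) -
                    ((z.2.1 - m'.1) ^+ 2 + (z.2.2 - m'.2) ^+ 2))).

Lemma measurable_likelihood_ratio (R : realType) (m m' : R * R) (s2 : R) :
  measurable_fun setT (likelihood_ratio m m' s2).
Proof.
have m1 : measurable_fun setT (fun z : R * (R * R) => z.2.1) by exact: measurableT_comp.
have m2 : measurable_fun setT (fun z : R * (R * R) => z.2.2) by exact: measurableT_comp.
apply: measurableT_comp => //; apply: measurable_funM; first by apply: measurable_funM.
by apply: measurable_funB; apply: measurable_funD; apply: measurable_funX; apply: measurable_funB.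
Qed.

Lemma outcome_measure_density (R : realType) (m m' : R * R) (s2 q : R) (B : set (R * R)) :
  0 < s2 -> measurable B -> 0 <= q ->
  (outcome_measure m' s2 q B =
   \int[outcome_measure m s2 q]_(x in B) (likelihood_ratio m m' s2 (q, x))%:E)%E.
Proof.
move=> s0 mB; rewrite le_eqVlt /outcome_measure => /orP[/eqP <-|q0].
  (* At zero power both laws are the same Dirac mass and the ratio is 1. *)
  rewrite ltxx; under eq_integral do rewrite /likelihood_ratio/= !mul0r expR0.
  by rewrite integral_cst// mul1e.
rewrite q0.
have mlr : measurable_fun setT (fun z => (likelihood_ratio m m' s2 (q, z))%:E).
  apply/measurable_EFinP.
  exact: (measurableT_comp (measurable_likelihood_ratio m m' s2) (measurable_pair1 q)).
rewrite (@ge0_integral_density_set _ _ _ (lebesgue2 R) (gauss2_measure m (s2 / (2 * q)))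
  _ (measurable_gauss_density2 m s2 q) _ _ (fun A => @gauss2E R m s2 q A s0 q0))//.
- transitivity (gauss2 m' (s2 / (2 * q)) B) => //; rewrite gauss2E//.
  apply: eq_integral => -[x y] _.
  rewrite -EFinM; congr (_%:E); rewrite /gauss_density /likelihood_ratio/=.
  rewrite mulrCA -expRD; congr (_ * expR _); ring.
- by move=> x; rewrite lee_fin gauss_density_ge0// ltW.
- by move=> x; rewrite lee_fin expR_ge0.
Qed.

Section outcome_kernel.
Context d (T : measurableType d) (R : realType) (m : R * R) (s2 : R).
Hypothesis s20 : 0 < s2.
Variable p : {mfun T >-> R}.

(** Measurability in the power rests on the Gaussian density formula, hence on [0 < s2]; that proof
    is an argument so that the kernel instances can be attached to the term. *)
Definition outcome_kernel (_ : 0 < s2) (y : T) : {measure set (R * R) -> \bar R} :=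
  outcome_measure m s2 (p y).

Let measurable_outcome_kernel B :
  measurable B -> measurable_fun [set: T] (outcome_kernel s20 ^~ B).
Proof.
move=> mB.
suff mo : measurable_fun setT (fun q => outcome_measure m s2 q B).
  exact: measurableT_comp mo (measurable_funPT p).
(* The truncation by [Num.max] makes [h] nonnegative for every real power, as Tonelli requires, and
   changes nothing at positive powers. The two outcome coordinates are then integrated out in turn,
   with the power as a parameter. *)
pose h (z : (R * measurableTypeR R) * measurableTypeR R) :=
  ((\1_B (z.1.2, z.2))%:E * (gauss_density m s2 (Num.max 0 z.1.1, (z.1.2, z.2)))%:E)%E.
have h0 z : (0 <= h z)%E.
  apply: mule_ge0; rewrite lee_fin//.
  by rewrite gauss_density_ge0// le_max lexx.
have mh : measurable_fun setT h.
  have m2 : measurable_fun setT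
      (fun z : (R * measurableTypeR R) * measurableTypeR R => (z.1.2, z.2) : R * R).
    by apply: measurable_fun_pair => //; exact: measurableT_comp.
  apply: emeasurable_funM; apply/measurable_EFinP.
    by apply: (@measurableT_comp _ _ _ _ _ _ (\1_B : R * R -> R) _ _ _ m2); exact: measurable_indic.
  apply: (@measurableT_comp _ _ _ _ _ _ (gauss_density m s2) _
    (fun z : (R * measurableTypeR R) * measurableTypeR R =>
      (Num.max 0 z.1.1, (z.1.2, z.2)) : R * (R * R))).
    exact: measurable_gauss_density.
  by apply: measurable_fun_pair => //; apply: measurable_maxr => //; exact: measurableT_comp.
pose h1 := fubini_F (@lebesgue_measure R) h.
have mh1 : measurable_fun setT h1.
  exact: (@measurable_fun_fubini_tonelli_F _ _ _ _ _ (@lebesgue_measure R) h mh h0).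
have h10 z : (0 <= h1 z)%E by exact: integral_ge0.
pose h2 := fubini_F (@lebesgue_measure R) h1.
have mh2 : measurable_fun setT h2.
  exact: (@measurable_fun_fubini_tonelli_F _ _ _ _ _ (@lebesgue_measure R) h1 mh1 h10).
rewrite (_ : (fun q => _) = (fun q : R => if (0 < q)%R then h2 q
  else \d_((0, 0)%R : R * R) B)%E); last first.
  apply/funext => q; rewrite /outcome_measure; case: ifPn => // q0.
  transitivity (gauss2 m (s2 / (2 * q)) B) => //; rewrite gauss2E//.
  rewrite (integral_gauss_density m s20 (ltW q0) mB).
  by apply: eq_integral => x _; apply: eq_integral => y _; rewrite /h /= max_r ?ltW.
by apply: measurable_fun_ifT => //; exact: measurable_fun_ltr.
Qed.

HB.instance Definition _ := isKernel.Build _ _ _ _ R (outcome_kernel s20) measurable_outcome_kernel.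

Let outcome_kernelT y : outcome_kernel s20 y setT = 1%E.
Proof.
rewrite /outcome_kernel /outcome_measure; case: ifP => _; last by rewrite /= /dirac indicE in_setT.
set sd := Num.sqrt (s2 / (2 * p y)).
transitivity ((normal_prob m.1 sd \x normal_prob m.2 sd)%E (setT `*` setT)).
  by rewrite setXTT.
rewrite product_measure1E// -[RHS]mule1.
by congr (_ * _)%E; exact: integral_normal_pdf.
Qed.

HB.instance Definition _ := Kernel_isProbability.Build _ _ _ _ R
  (outcome_kernel s20) outcome_kernelT.

End outcome_kernel.

(** * Change of measure along the history *)

Section ChangeOfMeasure.
Local Open Scope ereal_scope.

Section density_measure.
Context d (T : measurableType d) (R : realType).
Variables (mu : {measure set T -> \bar R}) (f : T -> R).
Hypotheses (mf : measurable_fun setT f) (f0 : forall x, (0 <= f x)%R).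

Definition density_measure (_ : measurable_fun setT f) (_ : forall x, (0 <= f x)%R)
  (A : set T) : \bar R := \int[mu]_(x in A) (f x)%:E.

Let density_measure0 : density_measure mf f0 set0 = 0.
Proof. exact: integral_set0. Qed.

Let density_measure_ge0 A : 0 <= density_measure mf f0 A.
Proof. by apply: integral_ge0 => x _; rewrite lee_fin. Qed.

Let density_measure_sigma_additive : semi_sigma_additive (density_measure mf f0).
Proof.
move=> F mF tF mUF; rewrite /density_measure ge0_integral_bigcup//; last first.
- by move=> x _; rewrite lee_fin.
- by apply: measurable_funTS; exact/measurable_EFinP.
by apply: is_cvg_ereal_nneg_natsum_cond => n _ _; apply: integral_ge0 => x _; rewrite lee_fin.
Qed.

HB.instance Definition _ := isMeasure.Build _ _ _ (density_measure mf f0)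
  density_measure0 density_measure_ge0 density_measure_sigma_additive.

End density_measure.

(** * Sigma-algebras of the history *)

Section History.
Context (R : realType) (K : nat) (d : measure_display) (T : measurableType d).
Variables (p : nat -> 'I_K -> {mfun T >-> R}).
Variables (X : nat -> 'I_K -> {mfun T >-> (R * R)%type}).

Definition history_gen (m n : nat) : set_system T :=
  [set A | (exists s k (B : set R),
                  [/\ (s < m)%N, measurable B & A = p s k @^-1` B]) \/
               (exists s k (B : set (R * R)),
                  [/\ (s < n)%N, measurable B & A = X s k @^-1` B])].

(** The sample space equipped with the coarser sigma-algebra of the first [n] rounds. The past
    becomes the value of the identity map into it, so kernels and disintegration apply with
    [Hist p X n] as the space of pasts. *)
Definition Hist n := g_sigma_algebraType (history_gen n n).

Lemma history_le m n m' n' : (m <= m')%N -> (n <= n')%N ->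
  history p X m n `<=` history p X m' n'.
Proof.
move=> mm nn; apply: sub_sigma_algebra2 => A [[s [k [B [sm mB ->]]]]|[s [k [B [sm mB ->]]]]].
  by left; exists s, k, B; split => //; exact: leq_trans mm.
by right; exists s, k, B; split => //; exact: leq_trans nn.
Qed.

Lemma history_measurable m n : history p X m n `<=` measurable.
Proof.
apply: smallest_sub; first exact: sigma_algebra_measurable.
by move=> A [[s [k [B [sm mB ->]]]]|[s [k [B [sm mB ->]]]]];
  rewrite -[X in measurable X]setTI; exact: measurable_funP.
Qed.

Lemma measurable_hist_id n : measurable_fun setT (id : T -> Hist n).
Proof. by move=> _ A mA; rewrite setTI; exact: (history_measurable mA). Qed.

Definition hist n : {mfun T >-> Hist n} :=
  HB.pack (id : T -> Hist n) (isMeasurableFun.Build _ _ _ _ _ (@measurable_hist_id n)).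

Lemma measurable_hist d' (U : measurableType d') n (f : T -> U) :
  (forall B, measurable B -> history p X n n (f @^-1` B)) ->
  measurable_fun setT (f : Hist n -> U).
Proof. by move=> h _ B mB; rewrite setTI; exact: h. Qed.

Lemma measurable_hist_outcome n t k : (t < n)%N ->
  measurable_fun setT (X t k : Hist n -> (R * R)%type).
Proof.
move=> tn; apply: measurable_hist => B mB; apply: sub_sigma_algebra.
by right; exists t, k, B.
Qed.

Lemma measurable_hist_power n t k : (t < n)%N -> measurable_fun setT (p t k : Hist n -> R).
Proof.
move=> tn; apply: measurable_hist => B mB; apply: sub_sigma_algebra.
by left; exists t, k, B.
Qed.

Hypothesis polp : policy p X.

Lemma measurable_hist_policy t k : measurable_fun setT (p t k : Hist t -> R).
Proof. by apply: measurable_hist => B mB; exact: polp.2. Qed.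

Lemma policy_ge0 t k w : (0 <= p t k w)%R.
Proof. by have /andP[] := (polp.1 t w).1 k. Qed.

Lemma policy_le1 t k w : (p t k w <= 1)%R.
Proof. by have /andP[] := (polp.1 t w).1 k. Qed.

(** Past events intersected with boxes of current outcomes: a pi-system on which
    [weighted_information] prescribes the probabilities. *)
Definition round_gen n : set_system T :=
  [set C | exists A (B : 'I_K -> set (R * R)),
    [/\ history p X n n A, forall k, measurable (B k) &
        C = A `&` [set w | forall k, B k (X n k w)]]].

(** The powers of round [n] bring no new event, since a policy makes them measurable for the earlier
    history; only the outcomes of round [n] do. *)
Lemma history_round_gen n : history p X n.+1 n.+1 `<=` <<s round_gen n >>.
Proof.
apply: smallest_sub; first exact: smallest_sigma_algebra.
have old A : history p X n n A -> <<s round_gen n >> A.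
  move=> hA; apply: sub_sigma_algebra; exists A, (fun=> setT); split => //.
  by apply/seteqP; split => // w [].
move=> A [[s [k [B [sm mB ->]]]]|[s [k [B [sm mB ->]]]]].
  apply: old; move: sm; rewrite ltnS leq_eqVlt => /orP[/eqP ->|sn]; first exact: polp.2.
  by apply: sub_sigma_algebra; left; exists s, k, B.
move: sm; rewrite ltnS leq_eqVlt => /orP[/eqP ->|sn]; last first.
  by apply: old; apply: sub_sigma_algebra; right; exists s, k, B.
(* Only arm [k] is constrained: the other sides of the box are [setT]. *)
apply: sub_sigma_algebra; exists setT, (fun j => if j == k then B else setT); split.
- exact: (@measurableT _ (Hist n)).
- by move=> j; case: ifP.
- apply/seteqP; split => w /=.
    by move=> BX; split => // j; case: ifPn => // /eqP ->.
  by case=> _ /(_ k); rewrite eqxx.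
Qed.

Lemma round_gen_setI n : setI_closed (round_gen n).
Proof.
move=> _ _ [A [B [hA mB ->]]] [A' [B' [hA' mB' ->]]].
exists (A `&` A'), (fun k => B k `&` B' k); split.
- exact: (@measurableI _ (Hist n)).
- by move=> k; exact: measurableI.
- apply/seteqP; split => w /=.
    by move=> [[Aw Bw] [A'w B'w]]; split => // k.
  by move=> [[Aw A'w] BB]; split; split => // k; have [] := BB k.
Qed.

Lemma measurable_outcomes n (S : {pred 'I_K}) (B : 'I_K -> set (R * R)) :
  (forall k, measurable (B k)) -> measurable [set w | forall k, k \in S -> B k (X n k w)].
Proof.
move=> mB.
rewrite (_ : [set w | _] = \bigcap_(k in [set k | k \in S]) (X n k @^-1` B k)).
  apply: fin_bigcap_measurable; first exact: finite_finset.
  by move=> k _; rewrite -[X in measurable X]setTI; exact: measurable_funP.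
by apply/seteqP; split => w /= h k; exact: h.
Qed.

Lemma round_gen_measurable n : round_gen n `<=` measurable.
Proof.
move=> _ [A [B [hA mB ->]]]; apply: measurableI; first exact: (history_measurable hA).
rewrite (_ : [set w | _] = [set w | forall k, k \in predT -> B k (X n k w)]).
  exact: measurable_outcomes.
by apply/seteqP; split => w /= h k => [_|]; exact: h.
Qed.

End History.

(** * Likelihood of one instance relative to another *)

Section Likelihood.
Context (R : realType) (K : nat) (d : measure_display) (T : measurableType d).
Variables (P : ('I_K -> R * R) -> ('I_K -> R) -> probability T R).
Variables (p : nat -> 'I_K -> {mfun T >-> R}).
Variables (X : nat -> 'I_K -> {mfun T >-> (R * R)%type}).
Hypothesis polp : policy p X.
Hypothesis wi : weighted_information P p X.
Variables (mu mu' : 'I_K -> R * R) (s : 'I_K -> R) (k0 : 'I_K).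
Hypothesis s0 : forall k, (0 < s k)%R.
Hypothesis mu'E : forall k, k != k0 -> mu' k = mu k.

(** Only arm [k0] enters: the powers are functions of the past and the other arms have equal
    conditional laws under both instances, so their factors cancel. *)
Definition likelihood n (w : T) : R :=
  (\prod_(t < n) likelihood_ratio (mu k0) (mu' k0) (s k0) (p t k0 w, X t k0 w))%R.

Lemma likelihood_ge0 n w : (0 <= likelihood n w)%R.
Proof. by apply: prodr_ge0 => t _; exact: expR_ge0. Qed.

Lemma likelihoodS n w : likelihood n.+1 w =
  (likelihood n w * likelihood_ratio (mu k0) (mu' k0) (s k0) (p n k0 w, X n k0 w))%R.
Proof. by rewrite /likelihood big_ord_recr. Qed.

Lemma measurable_likelihood n : measurable_fun setT (likelihood n : Hist p X n -> R).
Proof.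
apply: measurable_prod => t _.
apply: (@measurableT_comp _ _ _ _ _ _ (likelihood_ratio (mu k0) (mu' k0) (s k0)) _
    (fun w : Hist p X n => (p t k0 w, X t k0 w))).
  exact: measurable_likelihood_ratio.
apply: measurable_fun_pair; [exact: measurable_hist_power|exact: measurable_hist_outcome].
Qed.

Lemma measurable_likelihoodT n : measurable_fun setT (likelihood n).
Proof.
move=> _ B mB; rewrite setTI; apply: (@history_measurable _ _ _ _ p X n n).
have := @measurable_likelihood n measurableT B mB; rewrite setTI; exact.
Qed.

Definition power_mfun n k : {mfun Hist p X n >-> R} :=
  HB.pack (p n k : Hist p X n -> R)
    (isMeasurableFun.Build _ _ _ _ _ (@measurable_hist_policy _ _ _ _ p X polp n k)).

Definition arm_kernel (m : 'I_K -> R * R) n k : R.-pker Hist p X n ~> (R * R)%type :=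
  outcome_kernel (m k) (power_mfun n k) (s0 k).

(** The total kernels [arm_kernel] agree with [outcome_law] here because the powers of a policy are
    nonnegative. *)
Lemma round_law (m : 'I_K -> R * R) n A (B : 'I_K -> set (R * R)) :
  history p X n n A -> (forall k, measurable (B k)) ->
  P m s (A `&` [set w | forall k, B k (X n k w)]) =
  \int[P m s]_(w in A) (\prod_(k < K) arm_kernel m n k w (B k)).
Proof.
move=> hA mB; rewrite wi//; last exact: (history_le _ _ hA).
apply: eq_integral => w _; apply: eq_bigr => k _.
by rewrite /arm_kernel/= /outcome_kernel outcome_measureE//= (policy_ge0 polp).
Qed.

(** Induction on the number of rounds. Both sides are finite measures, so it suffices to compare
    them on the pi-system [round_gen]. There the claim is [one_step_density], with the history as
    past and arm [k0] as the arm whose law changes. *)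
Lemma change_of_measure n A : history p X n n A ->
  P mu' s A = \int[P mu s]_(w in A) (likelihood n w)%:E.
Proof.
elim: n A => [A hA|n IHn A hA].
  (* Before the first round there are no generators, hence only trivial events. *)
  have : [set set0; setT] A.
    move: A hA; apply: smallest_sub.
      split.
      - by left.
      - by move=> _ [->|->]; [right; rewrite setD0|left; rewrite setDT].
      - move=> F hF; have [[i Fi]|nF] := pselect (exists i, F i = setT).
          by right; apply/seteqP; split => // w _; exists i => //; rewrite Fi.
        left; apply/seteqP; split => // w [i _ Fiw].
        by case: (hF i) => Fi; [rewrite Fi in Fiw|case: nF; exists i].
    by move=> C [[t [k [B []]]]|[t [k [B []]]]].
  rewrite /likelihood; under eq_integral do rewrite big_ord0.
  by move=> [->|->]; rewrite integral_cst// mul1e ?measure0//;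
    exact: (etrans (probability_setT _) (esym (probability_setT _))).
pose m2 : {measure set T -> \bar R} :=
  density_measure (P mu s) (measurable_likelihoodT n.+1) (likelihood_ge0 n.+1).
suff m12 : forall C, round_gen p X n C -> P mu' s C = m2 C.
  apply: (@g_sigma_algebra_measure_unique _ _ _ (round_gen p X n) _
    (fun=> setT) _ _ (P mu' s) m2) => //.
  - exact: round_gen_measurable.
  - move=> _; exists setT, (fun=> setT); split => //.
    + exact: (@measurableT _ (Hist p X n)).
    + by apply/seteqP; split.
  - by rewrite bigcup_const.
  - exact: round_gen_setI.
  - by move=> _; exact: le_lt_trans (probability_le1 (P mu' s) measurableT) (ltry _).
  - exact: history_round_gen.
move=> _ [C [B [hC mB ->]]].
pose S := [set w | forall k, k \in [pred k | k != k0] -> B k (X n k w)].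
have CSE C' B' : C' `&` S `&` X n k0 @^-1` B' =
    C' `&` [set w | forall k, (if k == k0 then B' else B k) (X n k w)].
  apply/seteqP; split => w /=.
    by move=> [[Cw Sw] Bw]; split => // k; case: eqVneq => [->//|kk0]; exact: Sw.
  move=> [Cw h]; split; first split => //.
    by move=> k kk0; have := h k; rewrite (negbTE kk0).
  by have := h k0; rewrite eqxx.
(* The conditional probability of [S] given the past, the same under both instances since it
   involves only arms other than [k0]. *)
pose c (w : Hist p X n) := (\prod_(k < K | k != k0) fine (arm_kernel mu n k w (B k)))%R.
have cE w : (c w)%:E = \prod_(k < K | k != k0) arm_kernel mu n k w (B k).
  rewrite -prodEFin; apply: eq_bigr => k _; rewrite fineK// ge0_fin_numE//.
  by rewrite (le_lt_trans _ (ltry 1))//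
    -(@prob_kernel _ _ _ _ _ (arm_kernel mu n k) w) le_measure ?inE.
have mIf B' : measurable B' -> forall k, measurable (if k == k0 then B' else B k).
  by move=> mB' k; case: ifP.
(* Stated for a generic [m] so that it serves for both [mu] and [mu']. *)
have step (m : 'I_K -> R * R) : (forall k, k != k0 -> m k = mu k) ->
  forall C' B', history p X n n C' -> measurable B' ->
    P m s (C' `&` S `&` X n k0 @^-1` B') =
    \int[P m s]_(w in C') ((c w)%:E * arm_kernel m n k0 w B').
  move=> mE C' B' hC' mB'; rewrite CSE.
  rewrite (@round_law m n C' (fun k => if k == k0 then B' else B k))//; last exact: mIf.
  apply: eq_integral => w _; rewrite (bigD1 k0)//= eqxx muleC cE; congr (_ * _).
  by apply: eq_bigr => k kk0; rewrite (negbTE kk0) /arm_kernel mE.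
have -> : C `&` [set w | forall k, B k (X n k w)] = C `&` S `&` X n k0 @^-1` B k0.
  rewrite CSE; congr (_ `&` _); apply/seteqP; split => w h k; have := h k; case: eqVneq => // ->//.
rewrite /m2/= /density_measure.
have mS : measurable S.
  exact: (@measurable_outcomes _ _ _ _ X n [pred k | k != k0] B mB).
rewrite (@one_step_density _ _ _ T (Hist p X n) (R * R)%type R (P mu s) (P mu' s)
  (hist p X n) (X n k0) S c (likelihood n) (arm_kernel mu n k0) (arm_kernel mu' n k0)
  (fun z => likelihood_ratio (mu k0) (mu' k0) (s k0) (p n k0 z.1, z.2)))//.
- by apply: eq_integral => w _; rewrite likelihoodS.
- exact: le_lt_trans (probability_le1 (P mu s) measurableT) (ltry _).
- rewrite /c; under eq_fun do rewrite big_mkcond/=.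
  apply: measurable_prod => k _; case: (k != k0) => //; apply: measurableT_comp => //.
  exact: (measurable_kernel (arm_kernel mu n k)).
- by move=> w; apply: prodr_ge0 => k _; exact: fine_ge0.
- exact: measurable_likelihood.
- exact: likelihood_ge0.
- apply: (@measurableT_comp _ _ _ _ _ _ (likelihood_ratio (mu k0) (mu' k0) (s k0)) _
    (fun z : Hist p X n * (R * R) => (p n k0 z.1, z.2))).
    exact: measurable_likelihood_ratio.
  apply: measurable_fun_pair => //.
  apply: (@measurableT_comp _ _ _ _ _ _ (p n k0 : Hist p X n -> R) _ fst) => //.
  exact: measurable_hist_policy.
- by move=> z; exact: expR_ge0.
- by move=> A' B' hA' mB'; exact: step.
- by move=> A' B' hA' mB'; exact: step.
- move=> w B' mB'; apply: outcome_measure_density => //.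
  exact: (policy_ge0 polp).
Qed.
End Likelihood.

End ChangeOfMeasure.

(** * The information inequality *)

(** The identity on events extends to nonnegative functions by [ge0_integral_density]. This is done
    on [Hist p X n], because the density is known on events of the history only. *)
Lemma transport_ge0 (R : realType) (K : nat) (d : measure_display) (T : measurableType d)
  (P : ('I_K -> R * R) -> ('I_K -> R) -> probability T R)
  (p : nat -> 'I_K -> {mfun T >-> R}) (X : nat -> 'I_K -> {mfun T >-> (R * R)%type})
  (mu mu' : 'I_K -> R * R) (s : 'I_K -> R) (k0 : 'I_K) (n : nat) (f : T -> R) :
  policy p X -> weighted_information P p X ->
  (forall k, 0 < s k) -> (forall k, k != k0 -> mu' k = mu k) ->
  measurable_fun setT (f : Hist p X n -> R) -> (forall w, 0 <= f w) ->
  (\int[P mu' s]_w (f w)%:E =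
   \int[P mu s]_w (f w * likelihood p X mu mu' s k0 n w)%:E)%E.
Proof.
move=> polp wi s0 mu'E mf f0.
set M := likelihood p X mu mu' s k0 n.
have M0 w : 0 <= M w by exact: likelihood_ge0.
have mM : measurable_fun setT (M : Hist p X n -> R) by exact: measurable_likelihood.
pose Q : {measure set (Hist p X n) -> \bar R} := image_measure (P mu s) (hist p X n).
pose Q' : {measure set (Hist p X n) -> \bar R} := image_measure (P mu' s) (hist p X n).
transitivity (\int[Q']_w (f w)%:E)%E.
  rewrite ge0_integral_image_measure//; first exact/measurable_EFinP.
have mME : measurable_fun setT (fun w : Hist p X n => (M w)%:E) by exact/measurable_EFinP.
rewrite (@ge0_integral_density _ (Hist p X n) _ Q Q' (fun w => (M w)%:E))//.
- rewrite ge0_integral_image_measure//.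
  + by apply: emeasurable_funM => //; exact/measurable_EFinP.
  + by move=> w; rewrite mule_ge0// lee_fin.
- move=> A mA; rewrite ge0_integral_image_measure//.
  exact: (change_of_measure polp wi s0 mu'E).
- exact/measurable_EFinP.
Qed.

Lemma likelihoodE (R : realType) (K : nat) (d : measure_display) (T : measurableType d)
  (p : nat -> 'I_K -> {mfun T >-> R}) (X : nat -> 'I_K -> {mfun T >-> (R * R)%type})
  (mu mu' : 'I_K -> R * R) (s : 'I_K -> R) (k0 : 'I_K) (n : nat) (w : T) :
  likelihood p X mu mu' s k0 n w =
  expR (\sum_(t < n) p t k0 w / s k0 *
    ((((X t k0 w).1 - (mu k0).1) ^+ 2 + ((X t k0 w).2 - (mu k0).2) ^+ 2) -
     (((X t k0 w).1 - (mu' k0).1) ^+ 2 + ((X t k0 w).2 - (mu' k0).2) ^+ 2))).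
Proof. by rewrite expR_sum. Qed.

(** The inequality [1 + y <= expR y] at [l1 - ln c], [l1] and [l2], with weights [1 - Z], [Z] and
    [tau^-1]. The terms in [l1] and [l2] cancel and a slack [Z >= 0] is dropped. *)
Lemma pointwise_bound (R : realType) (c tau Z l1 l2 : R) :
  0 < c -> 0 < tau -> 0 <= Z <= 1 ->
  (1 - Z) * (1 - ln c) + tau^-1 <=
  (1 - Z) * expR l1 / c + Z * expR l1 + (- l1 - l2 / tau) + expR l2 / tau.
Proof.
move=> c0 t0 /andP[Z0 Z1].
have h1 : 1 + (l1 - ln c) <= expR l1 / c.
  by rewrite (le_trans (expR_ge1Dx _))// expRD expRN lnK.
have h2 : 1 + l1 <= expR l1 by exact: expR_ge1Dx.
have h3 : (1 + l2) / tau <= expR l2 / tau.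
  by rewrite ler_wpM2r ?expR_ge1Dx// invr_ge0 ltW.
have h4 : (1 - Z) * (1 + (l1 - ln c)) <= (1 - Z) * (expR l1 / c) by rewrite ler_wpM2l// subr_ge0.
have h5 : Z * (1 + l1) <= Z * expR l1 by rewrite ler_wpM2l.
rewrite mulrDl mul1r in h3; rewrite -mulrA; lra.
Qed.

(** Each log-likelihood has a part linear in the outcomes and a quadratic part in the shift. The
    linear part for [mu2] is [- tau] times that for [mu1], so dividing by [tau] cancels it. The
    quadratic parts add up to [1 + tau] times the squared length of [v]. *)
Lemma loglik_combination (R : realType) (K : nat) (d : measure_display) (T : measurableType d)
  (p : nat -> 'I_K -> {mfun T >-> R}) (X : nat -> 'I_K -> {mfun T >-> (R * R)%type})
  (mu mu1 mu2 : 'I_K -> R * R) (s : 'I_K -> R) (k0 : 'I_K) (v : R * R) (tau : R) (n : nat) (w : T) :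
  0 < tau -> 0 < s k0 ->
  mu1 k0 = ((mu k0).1 + v.1, (mu k0).2 + v.2) ->
  mu2 k0 = ((mu k0).1 - tau * v.1, (mu k0).2 - tau * v.2) ->
  - ln (likelihood p X mu mu1 s k0 n w) - ln (likelihood p X mu mu2 s k0 n w) / tau =
  (1 + tau) * ((v.1 ^+ 2 + v.2 ^+ 2) / s k0) * \sum_(t < n) p t k0 w.
Proof.
move=> t0 sk0 m1 m2; rewrite !likelihoodE !expRK m1 m2/=.
rewrite mulr_suml -!sumrN -big_split/= mulr_sumr; apply: eq_bigr => t _.
by field; rewrite !gt_eqF.
Qed.

(** * Expected powers, regret decomposition and information bound *)

Section ExpectedPower.
Context (R : realType) (K : nat) (d : measure_display) (T : measurableType d).
Variables (P : ('I_K -> R * R) -> ('I_K -> R) -> probability T R).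
Variables (p : nat -> 'I_K -> {mfun T >-> R}).
Variables (X : nat -> 'I_K -> {mfun T >-> (R * R)%type}).
Hypothesis polp : policy p X.
Implicit Types (mu : 'I_K -> R * R) (s : 'I_K -> R).

Definition total_power k n (w : T) : R := \sum_(t < n) p t k w.

Lemma total_power_ge0 k n w : 0 <= total_power k n w.
Proof. by apply: sumr_ge0 => t _; exact: (policy_ge0 polp). Qed.

Lemma total_power_le k n w : total_power k n w <= n%:R.
Proof.
rewrite -[leRHS]mulr1 -[n in leRHS]card_ord mulr_natl -sumr_const.
by apply: ler_sum => t _; exact: (policy_le1 polp).
Qed.

Lemma measurable_hist_total_power k n :
  measurable_fun setT (total_power k n : Hist p X n -> R).
Proof. by apply: measurable_sum => t; exact: measurable_hist_power. Qed.

Lemma measurable_total_power k n : measurable_fun setT (total_power k n).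
Proof. by apply: measurable_sum => t. Qed.

Lemma integrable_total_power mu s k n :
  (P mu s).-integrable setT (EFin \o total_power k n).
Proof.
apply: measurable_bounded_integrable => //.
- exact: le_lt_trans (probability_le1 (P mu s) measurableT) (ltry _).
- exact: measurable_total_power.
- exists n%:R; split; first exact: num_real.
  move=> x nx w _ /=; rewrite ger0_norm ?total_power_ge0//.
  exact: le_trans (total_power_le _ _ _) (ltW nx).
Qed.

Lemma expected_powerE mu s k n :
  (expected_power P p mu s k n)%:E = (\int[P mu s]_w (total_power k n w)%:E)%E.
Proof.
rewrite /expected_power fineK unlock//.
exact: integrable_fin_num (integrable_total_power mu s k n).
Qed.

Lemma integral_affine_power mu s k n (a b : R) :
  (\int[P mu s]_w (a + b * total_power k n w)%:E =
   (a + b * expected_power P p mu s k n)%:E)%E.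
Proof.
under eq_integral do rewrite EFinD EFinM.
have iN := integrable_total_power mu s k n.
rewrite integralD//=; last 2 first.
- exact: finite_measure_integrable_cst.
- exact: integrableZl iN.
rewrite integralZl// integral_cst//= -expected_powerE EFinD EFinM; congr (_ + _)%E.
by rewrite -[RHS]mule1; congr (_ * _)%E; exact: probability_setT.
Qed.

Lemma expected_power_ge0 mu s k n : 0 <= expected_power P p mu s k n.
Proof.
by rewrite -lee_fin expected_powerE; apply: integral_ge0 => w _; rewrite lee_fin total_power_ge0.
Qed.

Lemma expected_power_le mu s k n : expected_power P p mu s k n <= n%:R.
Proof.
have := integral_affine_power mu s k n n%:R (-1).
rewrite mulN1r => h; rewrite -subr_ge0 -lee_fin -h; apply: integral_ge0 => w _.
by rewrite lee_fin mulN1r subr_ge0 total_power_le.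
Qed.

Lemma expected_power_sum mu s n : \sum_(k < K) expected_power P p mu s k n = n%:R.
Proof.
apply: EFin_inj; rewrite -sumEFin; under eq_bigr do rewrite expected_powerE.
rewrite -ge0_integral_sum//; last 2 first.
- by move=> k; apply/measurable_EFinP; exact: measurable_total_power.
- by move=> k w _; rewrite lee_fin total_power_ge0.
rewrite (eq_integral (fun=> n%:R%:E)).
  rewrite integral_cst// -[RHS]mule1; congr (_ * _)%E; exact: probability_setT.
move=> w _; rewrite sumEFin; congr (_%:E); rewrite exchange_big/=.
under eq_bigr do rewrite (polp.1 _ w).2.
by rewrite sumr_const card_ord.
Qed.

Lemma expected_power_split mu s k n :
  expected_power P p mu s k n = \sum_(t < n) fine 'E_(P mu s)[p t k].
Proof.
apply: EFin_inj; rewrite expected_powerE -sumEFin.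
under eq_integral do rewrite -sumEFin.
have p0 t w : (0 <= (p t k w)%:E)%E by rewrite lee_fin (policy_ge0 polp).
have mp (t : nat) : measurable_fun setT (fun w => (p t k w)%:E) by exact/measurable_EFinP.
rewrite ge0_integral_sum//; apply: eq_bigr => t _.
rewrite fineK unlock// ge0_fin_numE ?integral_ge0//.
apply: (@le_lt_trans _ _ (\int[P mu s]_w (cst 1%E) w)%E).
  by apply: ge0_le_integral => // w _; rewrite lee_fin (policy_le1 polp).
rewrite integral_cst// mul1e.
exact: le_lt_trans (probability_le1 (P mu s) measurableT) (ltry _).
Qed.

(** The powers sum to [n], so what the optimal arm lacks is exactly what the other arms receive;
    regrouping gives the gaps. *)
Lemma expected_regretE mu s kstar n :
  expected_regret P p mu s kstar n =
  \sum_(k < K | k != kstar) gap mu kstar k * expected_power P p mu s k n.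
Proof.
rewrite /expected_regret exchange_big/=.
transitivity (\sum_(k < K) (enorm (mu k) * (k == kstar)%:R * n%:R -
    enorm (mu k) * expected_power P p mu s k n)).
  by apply: eq_bigr => k _;
    rewrite expected_power_split -mulr_sumr sumrB sumr_const card_ord mulrBr -mulrA mulr_natr.
rewrite big_split/= (bigD1 kstar)//= eqxx mulr1 [X in _ + X + _]big1 ?addr0; last first.
  by move=> k /negbTE ->; rewrite mulr0 mul0r.
rewrite -(expected_power_sum mu s n) mulr_sumr -big_split/= (bigD1 kstar)//= subrr add0r.
by apply: eq_bigr => k _; rewrite /gap mulrBl.
Qed.

Hypothesis wi : weighted_information P p X.

(** Integrates [pointwise_bound] under [mu], with [Z] the share of power spent on [k]. Terms
    carrying the likelihood of [mu1] become expectations under [mu1], and the likelihood of [mu2]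
    has mean 1, so [tau^-1] cancels on both sides. *)
Lemma information_bound mu mu1 mu2 s k v (c tau : R) n :
  (forall k, 0 < s k) -> (0 < n)%N -> 0 < c -> ln c <= 1 -> 0 < tau ->
  (forall j, j != k -> mu1 j = mu j) -> (forall j, j != k -> mu2 j = mu j) ->
  mu1 k = ((mu k).1 + v.1, (mu k).2 + v.2) ->
  mu2 k = ((mu k).1 - tau * v.1, (mu k).2 - tau * v.2) ->
  (1 - expected_power P p mu s k n / n%:R) * (1 - ln c) <=
  (1 - expected_power P p mu1 s k n / n%:R) / c + 1 +
  (1 + tau) * ((v.1 ^+ 2 + v.2 ^+ 2) / s k) * expected_power P p mu s k n.
Proof.
move=> s0 n0 c0 c1 t0 mu1E mu2E mu1k mu2k.
set N := expected_power P p mu s k n; set N1 := expected_power P p mu1 s k n.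
set D := (1 + tau) * _; set L := 1 - ln c.
have nR : 0 < n%:R :> R by rewrite ltr0n.
(* With [Z <= 1] this makes the left integrand nonnegative, as [ge0_le_integral] requires. *)
have L0 : 0 <= L by rewrite subr_ge0.
have D0 : 0 <= D.
  apply: mulr_ge0; first by rewrite addr_ge0// ltW.
  by rewrite divr_ge0 ?addr_ge0 ?sqr_ge0// ltW.
pose S := total_power k n.
pose M1 := likelihood p X mu mu1 s k n; pose M2 := likelihood p X mu mu2 s k n.
have M10 w : 0 <= M1 w by exact: likelihood_ge0.
have M20 w : 0 <= M2 w by exact: likelihood_ge0.
have mM1 : measurable_fun setT M1 by exact: measurable_likelihoodT.
have mM2 : measurable_fun setT M2 by exact: measurable_likelihoodT.
have mS : measurable_fun setT S by exact: measurable_total_power.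
have S0 w : 0 <= S w by exact: total_power_ge0.
have SZ w : 0 <= S w / n%:R <= 1.
  by rewrite divr_ge0//= ler_pdivrMr// mul1r total_power_le.
(* Chosen so that [a + b * S w] is [(1 - S w / n%:R) / c]; the affine form matches
   [integral_affine_power], which also explains the summands [0 +] below. *)
pose a := c^-1; pose b := - (c^-1 / n%:R).
have W0 w : 0 <= a + b * S w.
  rewrite /a /b (_ : _ + _ = (1 - S w / n%:R) / c); last by field; rewrite !gt_eqF.
  by apply: divr_ge0; [rewrite subr_ge0; have /andP[] := SZ w|exact: ltW].
have bound w : (L + tau^-1) + (- (L / n%:R)) * S w <=
   (a + b * S w) * M1 w + (0 + n%:R^-1 * S w) * M1 w + (0 + D * S w) + tau^-1 * M2 w.
  have := @pointwise_bound R c tau (S w / n%:R) (ln (M1 w)) (ln (M2 w)) c0 t0 (SZ w).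
  have e1 : expR (ln (M1 w)) = M1 w by rewrite /M1 likelihoodE expRK.
  have e2 : expR (ln (M2 w)) = M2 w by rewrite /M2 likelihoodE expRK.
  rewrite e1 e2 (loglik_combination _ _ _ _ t0 (s0 k) mu1k mu2k) -/D -/(S w) -/L => h.
  rewrite (_ : _ + _ = (1 - S w / n%:R) * L + tau^-1); last by ring.
  apply: (le_trans h); rewrite le_eqVlt; apply/orP; left; apply/eqP.
  by rewrite /a /b -/(total_power k n w) -/(S w); field; rewrite !gt_eqF.
have Z0 w : 0 <= 0 + n%:R^-1 * S w by rewrite add0r mulr_ge0// invr_ge0 ltW.
have DS0 w : 0 <= 0 + D * S w by rewrite add0r mulr_ge0.
have mE (f : T -> R) : measurable_fun setT f -> measurable_fun setT (fun w => (f w)%:E).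
  by move=> mf; exact/measurable_EFinP.
have maff (x y : R) : measurable_fun setT (fun w => x + y * S w).
  by apply: measurable_funD => //; exact: measurable_funM.
have mhaff (x y : R) : measurable_fun setT ((fun w => x + y * S w) : Hist p X n -> R).
  apply: measurable_funD => //; apply: measurable_funM => //.
  exact: measurable_hist_total_power.
have I1 : (\int[P mu s]_w ((a + b * S w) * M1 w)%:E = (a + b * N1)%:E)%E.
  rewrite -(transport_ge0 polp wi s0 mu1E (mhaff a b) W0).
  exact: integral_affine_power.
have I2 : (\int[P mu s]_w ((0 + n%:R^-1 * S w) * M1 w)%:E = (0 + n%:R^-1 * N1)%:E)%E.
  rewrite -(transport_ge0 polp wi s0 mu1E (mhaff 0 n%:R^-1) Z0).
  exact: integral_affine_power.
have ti0 (w : T) : 0 <= tau^-1 by rewrite invr_ge0 ltW.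
(* Transporting a constant shows that the likelihood of [mu2] integrates to 1. *)
have I4 : (\int[P mu s]_w (tau^-1 * M2 w)%:E = (tau^-1)%:E)%E.
  rewrite -(@transport_ge0 _ _ _ _ P p X mu mu2 s k n (fun=> tau^-1) polp wi s0 mu2E _ ti0)//.
  rewrite integral_cst// -[RHS]mule1; congr (_ * _)%E; exact: probability_setT.
have := integral_affine_power mu s k n (L + tau^-1) (- (L / n%:R)); rewrite -/N -/S.
have : (\int[P mu s]_w ((L + tau^-1) + (- (L / n%:R)) * S w)%:E <=
  \int[P mu s]_w (((a + b * S w) * M1 w)%:E + ((0 + n%:R^-1 * S w) * M1 w)%:E
     + (0 + D * S w)%:E + (tau^-1 * M2 w)%:E))%E.
  apply: ge0_le_integral => //.
  - move=> w _; rewrite lee_fin.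
    rewrite (_ : _ + _ = (1 - S w / n%:R) * L + tau^-1); last by ring.
    by rewrite addr_ge0 ?ti0// mulr_ge0// subr_ge0; have /andP[] := SZ w.
  - by apply: mE; exact: maff.
  - by apply: emeasurable_funD; [apply: emeasurable_funD; [apply: emeasurable_funD|]|];
      apply: mE => //; apply: measurable_funM => //; exact: maff.
  - by move=> w _; rewrite -!EFinD lee_fin.
rewrite ge0_integralD//; last 4 first.
- by move=> w _; rewrite !adde_ge0// lee_fin// mulr_ge0.
- by apply: emeasurable_funD; [apply: emeasurable_funD|];
    apply: mE => //; apply: measurable_funM => //; exact: maff.
- by move=> w _; rewrite lee_fin mulr_ge0// ti0.
- by apply: mE; exact: measurable_funM.
rewrite ge0_integralD//; last 4 first.
- by move=> w _; rewrite !adde_ge0// lee_fin// mulr_ge0.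
- by apply: emeasurable_funD; apply: mE => //; apply: measurable_funM => //; exact: maff.
- by move=> w _; rewrite lee_fin.
- by apply: mE; exact: maff.
rewrite ge0_integralD//; last 4 first.
- by move=> w _; rewrite lee_fin mulr_ge0.
- by apply: mE; apply: measurable_funM => //; exact: maff.
- by move=> w _; rewrite lee_fin mulr_ge0.
- by apply: mE; apply: measurable_funM => //; exact: maff.
rewrite I1 I2 I4 !integral_affine_power -/N -!EFinD lee_fin => h _.
(* Bounding this share by 1 yields the summand [1] of the conclusion. *)
have N1n : N1 / n%:R <= 1 by rewrite ler_pdivrMr// mul1r expected_power_le.
have e1 : (1 - N / n%:R) * L + tau^-1 = L + tau^-1 + - (L / n%:R) * N by ring.
have e2 : a + b * N1 = (1 - N1 / n%:R) / c by rewrite /a /b; field; rewrite !gt_eqF.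
rewrite -e1 e2 in h; rewrite [n%:R^-1 * N1]mulrC in h.
rewrite !add0r lerD2r in h; apply: (le_trans h); by rewrite lerD2r lerD2l.
Qed.
End ExpectedPower.

(** * Asymptotics *)

Lemma near_le_limn_einf (R : realType) (u : (\bar R)^nat) (a : \bar R) :
  (\forall n \near \oo, (a <= u n)%E) -> (a <= limn_einf u)%E.
Proof.
move=> [N _ aN]; rewrite limn_einf_lim; apply: lime_ge; first exact: is_cvg_einfs.
exists N => // n /= Nn; apply: le_ereal_inf_tmp => _ [m /= nm <-].
exact/aN/(leq_trans Nn).
Qed.

(** * Euclidean norm and displacements along a direction *)

Lemma enorm_sqr (R : realType) (m : R * R) : enorm m ^+ 2 = m.1 ^+ 2 + m.2 ^+ 2.
Proof. by rewrite sqr_sqrtr// addr_ge0// sqr_ge0. Qed.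

Lemma enorm_ge0 (R : realType) (m : R * R) : 0 <= enorm m.
Proof. exact: sqrtr_ge0. Qed.

(** Supplies the direction in which to move the mean of an arm: going along it is the shortest way
    to raise the norm, which keeps the information cost small. At the origin any unit vector works,
    and [(1, 0)] is taken. *)
Lemma enorm_direction (R : realType) (m : R * R) :
  exists u : R * R, [/\ u.1 ^+ 2 + u.2 ^+ 2 = 1, m.1 = enorm m * u.1 & m.2 = enorm m * u.2].
Proof.
have [m0|m0] := eqVneq (enorm m) 0.
  have /eqP := enorm_sqr m; rewrite m0 expr0n/= eq_sym paddr_eq0 ?sqr_ge0// !sqrf_eq0.
  move=> /andP[/eqP m1 /eqP m2]; exists (1, 0); rewrite /= m1 m2 !mul0r.
  by rewrite expr1n expr0n addr0.
exists (m.1 / enorm m, m.2 / enorm m); split => /=; [|by field|by field].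
by rewrite !exprMn -mulrDl -enorm_sqr -exprMn divff// expr1n.
Qed.

(** The shifted vector is [enorm m + x] times the unit vector [u], and this factor is
    nonnegative. *)
Lemma enorm_shift (R : realType) (m u : R * R) (x : R) :
  u.1 ^+ 2 + u.2 ^+ 2 = 1 -> m.1 = enorm m * u.1 -> m.2 = enorm m * u.2 -> 0 <= x ->
  enorm (m.1 + x * u.1, m.2 + x * u.2) = enorm m + x.
Proof.
move=> u1 m1 m2 x0; rewrite /(enorm (_, _))/= m1 m2 -!mulrDl !exprMn -mulrDr u1 mulr1.
by rewrite sqrtr_sqr ger0_norm// addr_ge0// enorm_ge0.
Qed.

(** Used with [l = ln n], [z] the share of power off the arm and [y] the information term. The
    assumption [2 <= tau * l] absorbs the additive constants and gives [(1 - 3 * tau) * l <= y]; the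
    factor [1 - 10 * tau] then pays for [(1 + tau) ^+ 3]. *)
Lemma scalar_bound (R : realFieldType) (tau eta l z y : R) :
  0 < tau -> tau < 1 / 10 -> eta = 1 - 10 * tau -> 0 <= l -> 2 <= tau * l ->
  1 - tau <= z -> z * (1 - (tau - 1) * l) <= 2 + y ->
  eta * (1 + tau) ^+ 3 * l <= y.
Proof.
move=> t0 t1 -> l0 lt z1 h.
have h1 : (1 - tau) * (1 - (tau - 1) * l) <= 2 + y.
  by apply: le_trans h; rewrite ler_wpM2r//; nra.
have h2 : (1 - 3 * tau) * l <= y by nra.
apply: (le_trans _ h2); rewrite ler_wpM2r//.
have : 0 <= tau ^+ 2 by rewrite sqr_ge0.
have : 0 <= tau ^+ 3 by rewrite exprn_ge0// ltW.
have : 0 <= tau ^+ 4 by rewrite exprn_ge0// ltW.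
nra.
Qed.

Section Asymptotics.
Context (R : realType) (K : nat) (d : measure_display) (T : measurableType d).
Variables (P : ('I_K -> R * R) -> ('I_K -> R) -> probability T R).
Variables (p : nat -> 'I_K -> {mfun T >-> R}).
Variables (X : nat -> 'I_K -> {mfun T >-> (R * R)%type}).
Hypothesis polp : policy p X.
Hypothesis wi : weighted_information P p X.
Hypothesis ue : uniformly_efficient P p.

Lemma efficient_near mu s kstar k (alpha e : R) :
  (forall k, 0 < s k) -> unique_best mu kstar -> k != kstar -> 0 < alpha -> 0 < e ->
  \forall n \near \oo, expected_power P p mu s k n <= e * n%:R `^ alpha.
Proof.
move=> s0 best kk a0 e0.
have /eqoP/(_ e e0) h := ue s0 best kk a0.
apply: filterS h => n; rewrite ger0_norm ?(expected_power_ge0 P polp)//.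
by rewrite ger0_norm ?powR_ge0.
Qed.

Lemma near_ln_ge (a : R) : \forall n \near \oo, a <= ln (n%:R : R).
Proof.
near=> n.
have n0 : 0 < n%:R :> R by rewrite ltr0n; near: n; exists 1%N.
rewrite -[leLHS]expRK ler_ln ?posrE ?expR_gt0//.
near: n; exact: nbhs_infty_ger.
Unshelve. all: by end_near. Qed.

Lemma power_lower_bound mu s kstar k (eta : R) :
  (forall k, 0 < s k) -> unique_best mu kstar -> k != kstar -> 0 < eta < 1 ->
  \forall n \near \oo,
    eta * (s k / gap mu kstar k ^+ 2) * ln n%:R <= expected_power P p mu s k n.
Proof.
move=> s0 best kk /andP[eta0 eta1].
set g := gap mu kstar k.
have g0 : 0 < g by rewrite subr_gt0; exact: best.
(* Solves [eta = 1 - 10 * tau], the form expected by [scalar_bound]. *)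
pose tau := (1 - eta) / 10.
have t0 : 0 < tau by rewrite divr_gt0// subr_gt0.
have t1 : tau < 1 / 10 by rewrite ltr_pM2r ?invr_gt0// gtrBl.
have etaE : eta = 1 - 10 * tau by rewrite /tau; field.
have [u [u1 mk1 mk2]] := enorm_direction (mu k).
(* Slightly more than the gap, so that arm [k] becomes the unique optimal arm of [mu1]. *)
pose x := (1 + tau) * g.
have x0 : 0 < x by rewrite mulr_gt0// addr_gt0.
pose v := (x * u.1, x * u.2).
pose mu1 j := if j == k then ((mu k).1 + v.1, (mu k).2 + v.2) else mu j.
pose mu2 j := if j == k then ((mu k).1 - tau * v.1, (mu k).2 - tau * v.2) else mu j.
have best1 : unique_best mu1 k.
  move=> j jk; rewrite /mu1 eqxx (negbTE jk) enorm_shift// ?ltW//.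
  have : enorm (mu j) <= enorm (mu kstar).
    by have [->//|jkstar] := eqVneq j kstar; exact/ltW/best.
  move=> /le_lt_trans; apply; rewrite -ltrBlDl -/(gap mu kstar k) -/g /x.
  by rewrite mulrDl mul1r ltrDl mulr_gt0.
have K0 : 0 < K%:R :> R by rewrite ltr0n (leq_ltn_trans _ (ltn_ord k)).
(* Under [mu1] all arms but [k], including [kstar], are suboptimal. The constant [K%:R^-1] makes
   their total power at most [n%:R] to the power [tau]. *)
have near1 : \forall n \near \oo, forall j, j != k ->
    expected_power P p mu1 s j n <= K%:R^-1 * n%:R `^ tau.
  have H j : j != k -> \forall n \near \oo, expected_power P p mu1 s j n <= K%:R^-1 * n%:R `^ tau.
    by move=> jk; apply: (efficient_near s0 best1 jk t0); rewrite invr_gt0.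
  apply: filter_forall => j; have [->|jk] := eqVneq j k; first by apply: nearW.
  by apply: filterS (H j jk).
near=> n.
have n0 : (0 < n)%N by near: n; exists 1%N.
have nR : 0 < n%:R :> R by rewrite ltr0n.
have n1 : 1 <= n%:R :> R by rewrite ler1n.
have lnn : 2 <= tau * ln n%:R.
  rewrite mulrC -ler_pdivrMr//; near: n; exact: near_ln_ge.
set l := ln n%:R.
set N := expected_power P p mu s k n.
have N0 : 0 <= N by exact: (expected_power_ge0 P polp).
have Nn : N / n%:R <= tau.
  rewrite ler_pdivrMr// (@le_trans _ _ (tau * n%:R `^ tau))//.
    by rewrite /N; near: n; apply: (efficient_near s0 best kk t0 t0).
  apply: ler_wpM2l; first exact: ltW.
  rewrite -[leRHS](powRr1 (ltW nR)); apply: ler_powR => //.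
  by apply: ltW; apply: (lt_trans t1); rewrite ltr_pdivrMr// mul1r ltr1n.
(* The product [c * n%:R] is the bound on the power off [k] under [mu1], so the term divided by [c]
   stays below 1, while [- ln c] is still [(1 - tau) * l]. *)
pose c := n%:R `^ (tau - 1).
have c0 : 0 < c by rewrite powR_gt0.
have lnc : ln c = (tau - 1) * l by rewrite ln_powR.
have l0 : 0 <= l by rewrite ln_ge0.
have N1 : (1 - expected_power P p mu1 s k n / n%:R) / c <= 1.
  have cn : c * n%:R = n%:R `^ tau.
    by rewrite -[X in c * X](powRr1 (ltW nR)) /c -powRD ?subrK// gt_eqF ?implybT.
  rewrite ler_pdivrMr// mul1r -(@ler_pM2r _ n%:R)// cn mulrBl mul1r divfK ?gt_eqF//.
  (* Writing [n] as the total power turns the deficit of arm [k] into the power of the other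
     arms. *)
  rewrite -{1}(expected_power_sum P polp mu1 s n) (bigD1 k)//= addrC addrK.
  have near1n : forall j, j != k -> expected_power P p mu1 s j n <= K%:R^-1 * n%:R `^ tau.
    by near: n.
  apply: (@le_trans _ _ (\sum_(j < K | j != k) K%:R^-1 * n%:R `^ tau)).
    by apply: ler_sum => j; exact: near1n.
  apply: (@le_trans _ _ (\sum_(j < K) K%:R^-1 * n%:R `^ tau)).
    rewrite big_mkcond; apply: ler_sum => j _; case: ifP => // _.
  by rewrite sumr_const card_ord -[leLHS]mulr_natr mulrAC mulVf ?gt_eqF// mul1r.
have := @information_bound _ _ _ _ P p X polp wi mu mu1 mu2 s k v c tau n s0 n0 c0.
rewrite -/N lnc => /(_ _ t0 _ _ _ _).
have c1 : (tau - 1) * l <= 1.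
  by rewrite (@le_trans _ _ 0)// mulr_le0_ge0// subr_le0; lra.
move=> /(_ c1); rewrite /mu1 /mu2 !eqxx => /(_ _ _ erefl erefl) h.
have {h} : (1 - N / n%:R) * (1 - (tau - 1) * l) <=
     2 + (1 + tau) * ((v.1 ^+ 2 + v.2 ^+ 2) / s k) * N.
  apply: le_trans (h _ _) _; [by move=> j /negbTE ->|by move=> j /negbTE ->|].
  by rewrite lerD2r (_ : 2 = 1 + 1)// lerD2r.
have -> : v.1 ^+ 2 + v.2 ^+ 2 = (1 + tau) ^+ 2 * g ^+ 2.
  by rewrite /v/=  (exprMn _ x) (exprMn _ x) -mulrDr u1 mulr1 exprMn.
rewrite -/l in lnn.
have Z1 : 1 - tau <= 1 - N / n%:R by rewrite lerD2l lerN2.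
set D := (1 + tau) * _ => h.
have sk := s0 k.
have g2 : 0 < g ^+ 2 by rewrite exprn_gt0.
have t10 : 0 < 1 + tau by rewrite addr_gt0.
(* Two factors [1 + tau] come from the length [x] of the shift, the third from
   [loglik_combination]. *)
have DE : D = (1 + tau) ^+ 3 * (g ^+ 2 / s k) by rewrite /D; field; rewrite gt_eqF.
have D0 : 0 < D by rewrite DE mulr_gt0 ?exprn_gt0// divr_gt0.
rewrite -(ler_pM2l D0).
have -> : D * (eta * (s k / g ^+ 2) * l) = eta * (1 + tau) ^+ 3 * l.
  by rewrite DE; field; rewrite !gt_eqF.
clear -h Z1 lnn l0 t0 t1 etaE eta0.
exact: (scalar_bound t0 t1 etaE l0 lnn Z1 h).
Unshelve. all: by end_near. Qed.
End Asymptotics.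

Theorem theorem1 (R : realType) (K : nat) (d : measure_display)
    (T : measurableType d)
    (P : ('I_K -> R * R) -> ('I_K -> R) -> probability T R)
    (p : nat -> 'I_K -> {mfun T >-> R})
    (X : nat -> 'I_K -> {mfun T >-> (R * R)%type})
    (mu : 'I_K -> R * R) (sigma2 : 'I_K -> R) (kstar : 'I_K) :
  (2 <= K)%N ->
  policy p X ->
  weighted_information P p X ->
  uniformly_efficient P p ->
  (forall k, 0 < sigma2 k) ->
  unique_best mu kstar ->
  ((\sum_(k < K | k != kstar) sigma2 k / gap mu kstar k)%:E <=
   limn_einf (fun n : nat =>
     (expected_regret P p mu sigma2 kstar n / ln n%:R)%:E))%E.
Proof.
move=> _ polp wi ue s0 best.
have gap0 k : k != kstar -> 0 < gap mu kstar k.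
  by move=> kk; rewrite subr_gt0; exact: best.
set C := \sum_(k < K | _) _.
have C0 : 0 <= C.
  by apply: sumr_ge0 => k kk; rewrite divr_ge0 ?(ltW (s0 k)) ?(ltW (gap0 k kk)).
set u := fun n : nat => _.
have lower eta : 0 < eta < 1 -> ((eta * C)%:E <= limn_einf u)%E.
  move=> eta01; apply: near_le_limn_einf.
  have H : \forall n \near \oo, forall k : 'I_K, k != kstar ->
      eta * (sigma2 k / gap mu kstar k ^+ 2) * ln n%:R <= expected_power P p mu sigma2 k n.
    apply: filter_forall => k; have [->|kk] := eqVneq k kstar; first by apply: nearW.
    by apply: filterS (power_lower_bound polp wi ue s0 best kk eta01).
  near=> n.
  (* Only large [n] matter for the lower limit, so the default values of the quotient at [n = 0] and
     [n = 1] have no effect. *)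
  have ln0 : 0 < ln (n%:R : R).
    by apply: (@lt_le_trans _ _ 1) => //; near: n; exact: near_ln_ge.
  have Hn : forall k : 'I_K, k != kstar ->
      eta * (sigma2 k / gap mu kstar k ^+ 2) * ln n%:R <= expected_power P p mu sigma2 k n.
    by near: n.
  rewrite lee_fin ler_pdivlMr// (expected_regretE P polp) mulr_sumr mulr_suml.
  apply: ler_sum => k kk; have g0 := gap0 k kk.
  apply: (le_trans _ (ler_wpM2l (ltW g0) (Hn k kk))).
  rewrite le_eqVlt; apply/orP; left; apply/eqP; field; rewrite gt_eqF//.
(* It remains to let [eta] tend to 1. The choice [eta = 1 - e / C] gives exactly [C - e]; it divides
   by [C], so the value 0 is treated apart. *)
have [C00|C0'] := eqVneq C 0.
  have := lower 2^-1; rewrite C00 mulr0; apply; lra.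
have Cp : 0 < C by rewrite lt_neqAle eq_sym C0' C0.
apply/lee_subgt0Pr => e e0.
(* When [C <= e] the choice [1 - e / C] is not positive, but [C - e <= 0] lies below the bound
   obtained for [eta = 2^-1]. *)
have [eC|Ce] := ltP e C; last first.
  apply: (@le_trans _ _ (2^-1 * C)%:E); last by apply: lower; lra.
  rewrite -EFinB lee_fin (@le_trans _ _ 0) ?subr_le0// mulr_ge0//; lra.
apply: le_trans (lower (1 - e / C) _).
  by rewrite -EFinB lee_fin mulrBl mul1r divfK.
by rewrite subr_gt0 ltr_pdivrMr// mul1r eC gtrBl divr_gt0.
Unshelve. all: by end_near. Qed.
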